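(* Let $\{X_j\}$ be a (strictly) stationary sequence of real random variables with continuous marginal distribution function $F(x)=\mathbb{P}(X_1\le x)$ such that for some constants $b>0$ and $B>0$ $$F(x+u)-F(x)\le B u^b,\qquad x\in\mathbb{R},\ u>0.$$ If $\{X_j\}$ is $\theta$-weakly dependent and $$\theta(r)=\mathcal{O}(r^{-\beta})\quad\text{for some }\beta>\frac{1+\sqrt5}{2}\Big(1+\frac1b\Big),$$ then $\{X_j\}$ admits a continuous phantom distribution function.
   Context: $M_n=\max_{1\le j\le n}X_j$. A distribution function $G$ is a phantom distribution function for the stationary sequence $\{X_j\}$ if $\sup_{u\in\mathbb{R}}|\mathbb{P}(M_n\le u)-G^n(u)|\to 0$ as $n\to\infty$, where $G^n(u)=(G(u))^n$. For $s\in\mathbb{N}$ let $\mathcal{M}^s$ be the family of all measurable non-constant functions $f:\mathbb{R}^s\to\mathbb{R}$ with $\sup|f|\le 1$. For $f\in\mathcal{M}^s$ put $$\mathrm{Lip}\, f=\sup_{(y_1,\dots,y_s)\ne(x_1,\dots,x_s)}\frac{|f(y_1,\dots,y_s)-f(x_1,\dots,x_s)|}{|y_1-x_1|+\cdots+|y_s-x_s|}\in(0,+\infty].$$ The $\theta$-weak dependence coefficient is $$\theta(r)=\sup\frac{\left|\mathrm{Cov}\left(f(X_{i_1},\dots,X_{i_s}),g(X_{j_1},\dots,X_{j_t})\right)\right|}{t\,\mathrm{Lip}\, g},$$ the supremum being over all $s,t\in\mathbb{N}$, $f\in\mathcal{M}^s$, $g\in\mathcal{M}^t$ and all indices $i_1\le\cdots\le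 i_s\le j_1\le\cdots\le j_t$ with $j_1-i_s\ge r$ (the ratio is $0$ when the denominator is $+\infty$). The sequence is $\theta$-weakly dependent if $\theta(r)\to 0$ as $r\to\infty$. *)

(* Defs.v *)
From HB Require Import structures.
From mathcomp Require Export all_boot all_order all_algebra.
From mathcomp Require Export all_classical all_reals all_analysis.
Set Implicit Arguments.
Unset Strict Implicit.
Unset Printing Implicit Defensive.
Import Order.TTheory GRing.Theory Num.Theory.
Import numFieldNormedType.Exports.
Local Open Scope classical_set_scope.
Local Open Scope ring_scope.

(* Sequences are indexed from 0: [X j] stands for the variable $X_{j+1}$ of the
   customary 1-based notation, so that $M_n$ is the maximum of X 0, ..., X n.-1.
   $\mathbb{R}^s$ is [s.-tuple R], with its product (Borel) sigma-algebra. *)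

Section phantom.
Context d (T : measurableType d) (R : realType) (P : probability T R).
Implicit Types X : nat -> {RV P >-> R}.

Definition joint X s (i : s.-tuple nat) (w : T) : s.-tuple R :=
  [tuple X (tnth i k) w | k < s].

Definition strictly_stationary X :=
  forall (s : nat) (i : s.-tuple nat) (h : nat) (A : set (s.-tuple R)),
    measurable A ->
    P (joint X [tuple (tnth i k + h)%N | k < s] @^-1` A) = P (joint X i @^-1` A).

Definition marginal_df X (x : R) : R := fine (cdf (X 0%N) x).

(* For n > 0 the default value X 0 w is one of the terms, so it is harmless. *)
Definition partial_max X (n : nat) (w : T) : R :=
  \big[Num.max/X 0%N w]_(j < n) X j w.

(* [cumulativeBounded 0 1] bundles monotonicity, right-continuity and the limits
   0 and 1 at -oo and +oo. *)
Definition phantom_df X (G : cumulativeBounded (0 : R) (1 : R)) :=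
  ereal_sup (range (fun u : R =>
    `|P [set w | (partial_max X n w <= u)%R] - (G u ^+ n)%:E|%E))
  @[n --> \oo] --> 0%E.

End phantom.

Definition test_functions (R : realType) (s : nat) : set (s.-tuple R -> R) :=
  [set f : s.-tuple R -> R | [/\ measurable_fun [set: s.-tuple R] f,
               exists x y, f x <> f y &
               forall x, `|f x| <= 1]].

Definition Lip (R : realType) (s : nat) (f : s.-tuple R -> R) : \bar R :=
  ereal_sup [set (`|f p.2 - f p.1| /
                  \sum_(k < s) `|tnth p.2 k - tnth p.1 k|)%:E |
             p in [set p : s.-tuple R * s.-tuple R | p.2 <> p.1]].

Section theta.
Context d (T : measurableType d) (R : realType) (P : probability T R).
Variable X : nat -> {RV P >-> R}.

(* The division is that of \bar R, where +oo^-1 = 0. *)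
Definition theta (r : nat) : \bar R :=
  ereal_sup [set q | exists (s t : nat)
      (f : s.-tuple R -> R) (g : t.-tuple R -> R)
      (i : s.-tuple nat) (j : t.-tuple nat),
    [/\ (0 < s)%N /\ (0 < t)%N,
        test_functions f /\ test_functions g,
        sorted leq (i ++ j),
        (last 0%N i + r <= head 0%N j)%N &
        q = (`|covariance P (f \o joint X i) (g \o joint X j)|
               / (t%:R%:E * Lip g))%E]].

Definition theta_weakly_dependent := theta r @[r --> \oo] --> 0%E.

End theta.

(* Main.v *)
From HB Require Import structures.
Require Import Defs.
From mathcomp Require Import measurable_realfun zify ring lra.
Set Implicit Arguments.
Unset Strict Implicit.
Unset Printing Implicit Defensive.
Import Order.TTheory GRing.Theory Num.Theory.
Import numFieldNormedType.Exports.
Local Open Scope classical_set_scope.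
Local Open Scope ring_scope.

(** Write H n u = P(M_n <= u).  Testing theta-dependence with the indicator of
{X_1, ..., X_p <= u} against a piecewise linear approximation, of slope 1/h, of
the indicator of {X_(p+r+1), ..., X_(p+r+q) <= u} gives, for q = O(r),
  P(both events) - H p u * H q u = O(r theta(r) / h + r h^b),
and h = r^-s with 1/b < s < beta - 1 makes this tend to 0 uniformly in p, q, u.
Iterating over blocks, H r u <= a < 1 forces
H (k r) u to be small for a suitable constant k; so as long as H N u >= 1/e the
gaps, of length a small multiple of N, have negligible weight, and n |-> H n u
is asymptotically multiplicative at scale N.  Hence, if N(u) is the last n
with H n u >= 1/e, H n u is uniformly close to exp(-n/N(u)), and any G with
G(u) = 1 - (1 + o(1)) / N(u) as N(u) tends to infinity is a phantom distribution
function.  To make G continuous, N(u) = #{n >= 1 : H n u >= 1/e} is replaced by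
the sum over n of the continuous functions min(1, n (H n u - 1/e))^+. *)

(** * Elementary inequalities for powers of numbers in the unit interval *)

Section real_powers.
Context (R : realType).
Implicit Types (a y eps : R) (k : nat).

Lemma exists_expr_le a eps : 0 <= a < 1 -> 0 < eps ->
  exists k, a ^+ k.+1 <= eps.
Proof.
move=> /andP[a0 a1] e0.
have /cvgrPdist_le/(_ eps e0)[k _ /(_ k.+1)] : (a ^+ n) @[n --> \oo] --> (0 : R).
  by apply: cvg_expr; rewrite ger0_norm.
by rewrite /= leqnSn sub0r normrN ger0_norm ?exprn_ge0// => /(_ isT); exists k.
Qed.

Lemma ler_distX a y k : 0 <= a <= 1 -> 0 <= y <= 1 ->
  `|a ^+ k - y ^+ k| <= k%:R * `|a - y|.
Proof.
move=> /andP[a0 a1] /andP[y0 y1]; elim: k => [|k IH].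
  by rewrite !expr0 subrr normr0 mul0r.
rewrite !exprS (_ : _ - _ = a * (a ^+ k - y ^+ k) + y ^+ k * (a - y)); last ring.
rewrite (le_trans (ler_normD _ _))// !normrM mulrSr mulrDl mul1r.
rewrite !(ger0_norm a0) (ger0_norm (exprn_ge0 _ y0)) lerD//.
  by rewrite (le_trans _ IH)// ler_piMl.
by rewrite ler_piMl// exprn_ile1.
Qed.

(** A converse to [ler_distX]: closeness of the [k]-th powers forces closeness of the bases as long
    as [y ^+ k] stays away from 0. *)
Lemma mulr_subX_le a y k : 0 <= a -> a <= y <= 1 -> (0 < k)%N ->
  (y - a) * y ^+ k <= y ^+ k - a ^+ k.
Proof.
move=> a0 /andP[ay y1]; case: k => // k _.
have y0 := le_trans a0 ay.
have h : a ^+ k <= y ^+ k by rewrite lerXn2r.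
have h1 : a ^+ k.+1 <= a * y ^+ k by rewrite exprS ler_wpM2l.
have h2 : y ^+ k.+1 <= y ^+ k by rewrite exprS ler_piMl// exprn_ge0.
have h3 : (y - a) * y ^+ k.+1 <= (y - a) * y ^+ k by rewrite ler_wpM2l// subr_ge0.
apply: (le_trans h3); rewrite mulrBl -exprS lerD2l lerN2 //.
Qed.

End real_powers.

(** * Asymptotic multiplicativity and the exponential limit, from the mixing inequality *)

Section asymptotic_multiplicativity.
Context (R : realType) (H : nat -> R -> R).
Hypothesis H0 : forall u, H 0 u = 1.
Hypothesis H_ge0 : forall n u, 0 <= H n u.
Hypothesis H_noninc : forall m n u, (m <= n)%N -> H n u <= H m u.
Hypothesis H_mix : forall L (eps : R), 0 < eps ->
  exists r0, forall r p q u, (r0 <= r)%N -> (q <= L * r)%N ->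
    H (p + r + q) u <= H p u * H q u + eps /\
    H p u * H q u <= H (p + r + q) u + (1 - H r u) + eps.

Implicit Types (a gam eps : R).

Let H_le1 n u : H n u <= 1.
Proof. by rewrite -(H0 u) H_noninc. Qed.

(** Blocks of length [r], separated by gaps of length [r], each contribute a factor at most [a] up
    to a mixing error. The point is that [k] depends on neither [r] nor [u]. *)
Lemma decay a eps : a < 1 -> 0 < eps ->
  exists k r0, (0 < k)%N /\
    forall r u, (r0 <= r)%N -> H r u <= a -> H (k * r) u <= eps.
Proof.
move=> a1 e0.
have [||j hj] := @exists_expr_le R (Num.max 0 a) (eps / 2).
- by rewrite le_max lexx/= gt_max ltr01.
- by rewrite divr_gt0.
(* Each of the [j.+1] blocks costs one mixing error; together they cost [eps / 2]. *)
have e'0 : 0 < eps / 2 / j.+1%:R by rewrite !divr_gt0.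
have [r0 hr0] := H_mix 1 e'0.
exists (2 * j.+1)%N, r0; split=> // r u rr0 Hra.
have pw i : H (2 * i * r) u <= H r u ^+ i + i%:R * (eps / 2 / j.+1%:R).
  elim: i => [|i IH]; first by rewrite muln0 mul0n H0 expr0 mul0r addr0.
  have [+ _] := hr0 r (2 * i * r)%N r u rr0 (eq_leq (esym (mul1n r))).
  rewrite (_ : (_ + r + r = 2 * i.+1 * r)%N); last by lia.
  move=> h; apply: (le_trans h).
  rewrite [i.+1%:R]mulrSr mulrDl mul1r addrA lerD2r exprSr.
  rewrite (le_trans (ler_wpM2r (H_ge0 _ _) IH))// mulrDl lerD2l.
  by rewrite ler_piMr// mulr_ge0// ltW.
apply: (le_trans (pw _)).
rewrite mulrC divfK ?pnatr_eq0// [leRHS]splitr lerD2r (le_trans _ hj)//.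
by rewrite lerXn2r ?nnegrE ?le_max ?H_ge0 ?lexx ?Hra ?orbT.
Qed.

(** If [H N u] is not small, [H r u] is near 1 for [r] a small fixed fraction of [N]: otherwise
    [decay] would bring [H (k * r) u], hence [H N u], below [gam]. Inserting or removing a gap of
    length [r] then changes little. *)
Lemma asymp_mult gam eps : 0 < gam -> 0 < eps ->
  exists N0, forall N u, (N0 <= N)%N -> gam <= H N u ->
    1 - eps <= H 1 u /\
    forall p q, (q <= N)%N -> `|H (p + q) u - H p u * H q u| <= eps.
Proof.
move=> g0 e0.
have [||k [r0 [k0 hk]]] := @decay (1 - eps / 3) (gam / 2); [lra|lra|].
have [|r1 hr1] := @H_mix (2 * k) (eps / 3); first lra.
exists (k * (r0 + r1).+1)%N => N u hN gN.
pose r := (N %/ k)%N.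
have hr : ((r0 + r1).+1 <= r)%N by rewrite leq_divRL// mulnC.
have rN : (k * r <= N)%N by rewrite mulnC leq_divM.
(* This makes every [q <= N] admissible in the mixing inequality with [L = 2 * k]. *)
have Nr : (N <= 2 * k * r)%N.
  have := ltn_ceil N k0; rewrite -/r mulnC => h.
  by rewrite (leq_trans (ltnW h))//; nia.
have Hr : 1 - eps / 3 < H r u.
  rewrite ltNge; apply/negP => /hk => /(_ ltac:(lia)) h.
  have := le_trans gN (H_noninc u rN); lra.
have mix p q : (q <= N)%N -> H (p + r + q) u <= H p u * H q u + eps / 3 /\
    H p u * H q u <= H (p + r + q) u + eps / 3 + eps / 3.
  move=> qN; have [|| h1 h2] := hr1 r p q u; [lia|lia|split=> //].
  by apply: (le_trans h2); lra.
split; first by have := @H_noninc 1 r u ltac:(lia); lra.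
move=> p q qN; rewrite ler_norml.
(* A block of length [q >= r] gives up its first [r] terms as the gap, which changes [H q u] little
   by the case [p = 0] of [mix]. A shorter block has [H q u] near 1, and both terms are near
   [H p u]. *)
have [rq|qr] := leqP r q.
  have := @mix p (q - r)%N ltac:(lia); have [_] := @mix 0 (q - r)%N ltac:(lia).
  rewrite H0 mul1r add0n -addnA subnKC// => h1 [h2 h3].
  have h4 := H_noninc u (leq_subr r q).
  have h5 := H_ge0 p u; have h6 := H_le1 p u.
  have h7 := ler_wpM2l h5 h1; have h8 := ler_wpM2l h5 h4.
  apply/andP; split; last by nra.
  lra.
have := @mix p 0 ltac:(lia); rewrite H0 mulr1 addn0 => -[_ h1].
have h2 := @H_noninc (p + q) (p + r) u ltac:(lia).
have h3 := @H_noninc q r u ltac:(lia).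
have h4 := @H_noninc p (p + q) u ltac:(lia).
have h5 := H_ge0 p u; have h6 := H_le1 p u; have h7 := H_le1 q u.
by apply/andP; split; nra.
Qed.

(** Cut the crossing time [N] into [k] blocks. Multiplicativity makes one block worth about
    [expR (- k%:R^-1)], hence [j] blocks about [expR (- (j%:R / k%:R))]; monotonicity in [n] fills
    in the times between. *)
Lemma asymp_exp eps : 0 < eps ->
  exists N0, forall N u, (N0 <= N)%N ->
    expR (-1) <= H N u -> H N.+1 u <= expR (-1) ->
    forall m, `|H m u - expR (- (m%:R / N%:R))| <= eps.
Proof.
move=> e0.
pose gam : R := expR (-1); have g0 : 0 < gam by exact: expR_gt0.
(* An error [2 / k%:R] arises for [m <= k * N], and one more [k%:R^-1] in the tail. *)
have [k k2 hk] : exists2 k, (1 < k)%N & 3 / k%:R <= eps.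
  exists (Num.truncn (3 / eps)).+2 => //.
  rewrite ler_pdivrMr// mulrC -ler_pdivrMr//.
  by rewrite ltW// (lt_le_trans (truncnS_gt _))// ler_nat.
have kgt0 : (0 < k)%N by exact: ltnW.
have k0 : 0 < k%:R :> R by rewrite ltr0n.
pose y : R := expR (- k%:R^-1).
have y01 : 0 <= y <= 1 by rewrite expR_ge0/= -expR0 ler_expR oppr_le0 invr_ge0 ltW.
have yX j : y ^+ j = expR (- (j%:R / k%:R)).
  by rewrite -expRM_natl -mulrN.
have yk : y ^+ k = gam by rewrite yX divff ?gt_eqF.
have y1 : 1 - y <= k%:R^-1 by have := expR_ge1Dx (- k%:R^-1 : R); rewrite -/y; lra.
have ek : expR (- k%:R) <= (k%:R^-1 : R).
  rewrite expRN lef_pV2 ?posrE ?expR_gt0//.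
  by have := expR_ge1Dx (k%:R : R); lra.
(* Chosen so that the errors of at most [k ^ 2 + 1] blocks add up to [k%:R^-1], as [De] records. *)
pose D : R := (k ^ 2).+1%:R * (k%:R / gam + 3).
have D0 : 0 < D by rewrite mulr_gt0// addr_gt0// divr_gt0.
pose e' := k%:R^-1 / D.
have e'0 : 0 < e' by rewrite divr_gt0// invr_gt0.
have [N0 hN0] := asymp_mult g0 e'0.
exists (N0 + k)%N => N u hN HN HN1.
have N0N : (N0 <= N)%N by exact: leq_trans (leq_addr _ _) hN.
have kN : (k <= N)%N by exact: leq_trans (leq_addl _ _) hN.
have N_gt0 : (0 < N)%N by exact: leq_trans kgt0 kN.
have [H1 hm] := hN0 N u N0N HN.
have N0' : 0 < N%:R :> R by rewrite ltr0n.
have pw q j : (q <= N)%N -> `|H (j * q) u - H q u ^+ j| <= j%:R * e'.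
  move=> qN; elim: j => [|j IH]; first by rewrite mul0n H0 expr0 subrr normr0 mul0r.
  have := hm (j * q)%N q qN; rewrite -mulSnr exprSr mulrSr mulrDl mul1r => h.
  rewrite (_ : _ - _ = (H (j.+1 * q) u - H (j * q) u * H q u)
     + (H (j * q) u - H q u ^+ j) * H q u); last ring.
  rewrite (le_trans (ler_normD _ _))// addrC lerD// normrM (le_trans _ IH)//.
  by rewrite ler_piMr// ger0_norm.
(* H M u ^+ k and H M.+1 u ^+ k both approximate [expR (-1) = y ^+ k]: the first
   from above, as M * k <= N, the second from below, as N < M.+1 * k. *)
pose M := (N %/ k)%N.
have kM : (M * k <= N)%N by rewrite leq_divM.
have kM1 : (N < M.+1 * k)%N by rewrite ltn_ceil.
have MN : (M <= N)%N by exact: leq_div.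
have M1N : (M.+1 <= N)%N by exact: ltn_Pdiv.
pose c := k%:R * e' / gam.
have c0 : 0 <= c by rewrite !mulr_ge0 ?invr_ge0// ltW.
have aM : y - c <= H M u.
  have [//|ay] := leP (y - c) (H M u).
  have ay' : H M u <= y <= 1 by rewrite (andP y01).2 andbT; lra.
  have := mulr_subX_le (H_ge0 M u) ay' kgt0.
  have := pw M k MN; rewrite ler_norml => /andP[_].
  have := H_noninc u kM; rewrite mulnC yk => h1 h2.
  have : H N u <= H M u ^+ k + k%:R * e' by lra.
  move: HN; rewrite -/gam => h3 h4 h5.
  have : (y - H M u) * gam <= k%:R * e' by lra.
  rewrite -ler_pdivlMr// -/c; lra.
have aM1 : H M.+1 u <= y + c.
  have [//|ya] := leP (H M.+1 u) (y + c).
  have ay' : y <= H M.+1 u <= 1 by rewrite H_le1 andbT; lra.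
  have := mulr_subX_le (andP y01).1 ay' kgt0.
  have := pw M.+1 k M1N; rewrite ler_norml => /andP[+ _].
  have := H_noninc u kM1; rewrite mulnC yk => h1 h2 h3.
  have h4 : gam <= H M.+1 u ^+ k.
    by rewrite -yk lerXn2r ?nnegrE ?(andP y01).1//; case/andP: ay'.
  move: HN1; rewrite -/gam => h5.
  have h6 : (H M.+1 u - y) * gam <= (H M.+1 u - y) * H M.+1 u ^+ k.
    by rewrite ler_wpM2l//; lra.
  have : (H M.+1 u - y) * gam <= k%:R * e' by lra.
  rewrite -ler_pdivlMr// -/c; lra.
(* As [H 1 u] is near 1, one more term changes little; the one-sided bounds at [M] and [M.+1]
   thereby become two-sided. *)
have MM1 : H M u <= H M.+1 u + e' + e'.
  have := hm M 1%N N_gt0; rewrite addn1 ler_norml => /andP[h1 _].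
  have h2 := H_le1 M u; have h3 := H_ge0 M u; nra.
have M1M := H_noninc u (leqnSn M).
pose c' := c + e' + e'.
have apx q j : (q == M) || (q == M.+1) -> `|H (j * q) u - y ^+ j| <= j%:R * (c' + e').
  move=> hq.
  have qN : (q <= N)%N by case/orP: hq => /eqP ->.
  have hqc : `|H q u - y| <= c'.
    rewrite ler_norml /c'; case/orP: hq => /eqP ->; lra.
  have h1 := pw q j qN.
  have h2 : `|H q u ^+ j - y ^+ j| <= j%:R * c'.
    by rewrite (le_trans (ler_distX _ _ _)) ?H_ge0//= ler_wpM2l.
  rewrite (_ : _ - _ = (H (j * q) u - H q u ^+ j) + (H q u ^+ j - y ^+ j)); last ring.
  by rewrite (le_trans (ler_normD _ _))// mulrDr addrC lerD.
have De : (k ^ 2).+1%:R * (c' + e') = k%:R^-1.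
  rewrite (_ : c' + e' = (k%:R / gam + 3) * e'); last by rewrite /c' /c; ring.
  by rewrite mulrA -/D mulrC divfK ?gt_eqF.
(* Here [m] lies between [j * M] and [j.+1 * M.+1] with [j <= k ^ 2], and [H] is known at both ends
   to within [k%:R^-1]. The limits [y ^+ j] and [y ^+ j.+1] differ by at most [1 - y <= k%:R^-1]. *)
have small m : (m <= k * N)%N -> `|H m u - expR (- (m%:R / N%:R))| <= 2 / k%:R.
  move=> mk; pose j := ((m * k) %/ N)%N.
  have jN : (j * N <= m * k)%N by rewrite leq_divM.
  have jN1 : (m * k < j.+1 * N)%N by rewrite ltn_ceil.
  have jk : (j.+1 <= (k ^ 2).+1)%N.
    by rewrite ltnS -(leq_pmul2r N_gt0) (leq_trans jN)//
      expnS expn1 mulnAC leq_mul2r mk orbT.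
  have jM : (j * M <= m)%N.
    by rewrite -(leq_pmul2r kgt0) -mulnA (leq_trans _ jN)// leq_mul2l kM orbT.
  have jM1 : (m <= j.+1 * M.+1)%N.
    by rewrite -(leq_pmul2r kgt0) -mulnA (leq_trans (ltnW jN1))// leq_mul2l ltnW ?orbT.
  have := apx M j; rewrite eqxx => /(_ isT); rewrite ler_norml => /andP[_ h1].
  have := apx M.+1 j.+1; rewrite eqxx orbT => /(_ isT); rewrite ler_norml => /andP[h2 _].
  have h3 := H_noninc u jM; have h4 := H_noninc u jM1.
  have c'0 : 0 <= c' + e' by rewrite /c'; lra.
  have h5 : j.+1%:R * (c' + e') <= k%:R^-1.
    by rewrite -De ler_wpM2r ?ler_nat.
  have h6 : j%:R * (c' + e') <= k%:R^-1.
    by rewrite (le_trans _ h5)// ler_wpM2r// ler_nat.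
  have h7 : y ^+ j.+1 <= expR (- (m%:R / N%:R)).
    by rewrite yX ler_expR lerN2 ler_pdivrMr// mulrAC ler_pdivlMr// -!natrM ler_nat ltnW.
  have h8 : expR (- (m%:R / N%:R)) <= y ^+ j.
    by rewrite yX ler_expR lerN2 ler_pdivlMr// mulrAC ler_pdivrMr// -!natrM ler_nat.
  have h9 : y ^+ j - y ^+ j.+1 <= k%:R^-1.
    rewrite exprS -{1}[y ^+ j]mul1r -mulrBl (le_trans _ y1)//.
    rewrite ler_piMr ?subr_ge0 ?(andP y01).2//.
    by rewrite exprn_ile1//; case/andP: y01.
  rewrite ler_norml; lra.
(* Past [k * N] both quantities are at most [3 / k%:R] by monotonicity. *)
move=> m; have [/small h|km] := leqP m (k * N).
  by apply: (le_trans h); lra.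
have := small (k * N)%N (leqnn _); rewrite natrM mulfK ?gt_eqF// ler_norml => /andP[_ h1].
have h2 := H_noninc u (ltnW km).
have h3 : expR (- (m%:R / N%:R)) <= expR (- k%:R) :> R.
  by rewrite ler_expR lerN2 ler_pdivlMr// -natrM ler_nat ltnW.
have h4 := H_ge0 m u; have h5 := expR_ge0 (- (m%:R / N%:R) : R).
rewrite ler_norml; lra.
Qed.

End asymptotic_multiplicativity.

(** * The ratio [x / (x + 1)], through which a level time becomes a value of the phantom *)

Section ratio.
Context (R : realType).
Implicit Types x y eta eps lambda : R.

Lemma ler_ratio x y : 0 <= x -> x <= y -> x / (x + 1) <= y / (y + 1).
Proof.
move=> x0 xy.
rewrite ler_pdivrMr ?ltr_wpDl// mulrAC ler_pdivlMr ?ltr_wpDl ?(le_trans x0)//.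
by rewrite !mulrDr !mulr1 mulrC lerD2l.
Qed.

Lemma ratio_ge0_lt1 x : 0 <= x -> 0 <= x / (x + 1) < 1.
Proof.
move=> x0; have x1 : 0 < x + 1 by rewrite ltr_wpDl.
by rewrite divr_ge0 ?(ltW x1)//= ltr_pdivrMr// mul1r ltrDl.
Qed.

Lemma ratio_near1 eta eps : 0 < eta -> 0 < eps ->
  exists N : nat, 1 - eps <= N%:R * eta / (N%:R * eta + 1).
Proof.
move=> n0 e0; exists (Num.truncn (eps^-1 / eta)).+1.
set N := (_.+1)%:R.
have h : eps^-1 <= N * eta by rewrite -ler_pdivrMr// ltW// truncnS_gt.
have h0 : 0 < N * eta by rewrite (lt_le_trans _ h)// invr_gt0.
rewrite ler_pdivlMr ?addr_gt0//.
move: h; rewrite -[_^-1]mul1r ler_pdivrMr// => h.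
nra.
Qed.

(** Because [expR (- x) * x <= 1], rescaling time by [lambda] moves the exponential by an amount
    bounded uniformly in [x]. *)
Lemma expRN_scale_le x lambda : 0 <= x -> 1 <= lambda ->
  expR (- x) - expR (- (lambda * x)) <= lambda - 1.
Proof.
move=> x0 l1.
rewrite (_ : - (lambda * x) = - x + - ((lambda - 1) * x)); last ring.
rewrite expRD; have := expR_ge1Dx (- ((lambda - 1) * x)) => h1.
have h2 : expR (- x) * x <= 1.
  rewrite expRN mulrC ler_pdivrMr ?expR_gt0// mul1r.
  by rewrite (le_trans _ (expR_ge1Dx _))// lerDr.
have h3 := ler_wpM2l (expR_ge0 (- x)) h1.
have h4 : (lambda - 1) * (expR (- x) * x) <= lambda - 1.
  by rewrite ler_piMr// subr_ge0.
rewrite mulrDr mulr1 mulrN mulrCA in h3; lra.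
Qed.

(** The ratio is [1 - (x + 1)^-1] and its inverse is [1 + x^-1], so both bounds are instances of
    [1 + t <= expR t]. *)
Lemma expR_ratio_bounds x : 0 < x ->
  expR (- x^-1) <= x / (x + 1) <= expR (- (x + 1)^-1).
Proof.
move=> x0; have x1 : 0 < x + 1 by rewrite addr_gt0.
have E : x / (x + 1) = 1 - (x + 1)^-1 by field; rewrite gt_eqF.
apply/andP; split; last by rewrite E; exact: expR_ge1Dx.
rewrite expRN -[leRHS]invrK lef_pV2 ?posrE ?expR_gt0 ?invr_gt0 ?divr_gt0//.
rewrite invf_div (_ : _ / x = 1 + x^-1) ?expR_ge1Dx//.
by rewrite mulrDl divff ?gt_eqF// div1r.
Qed.

End ratio.

(** * Construction of a continuous phantom from [H] *)

Section phantom_construction.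
Context (R : realType) (H : nat -> R -> R).
Hypothesis H0 : forall u, H 0 u = 1.
Hypothesis H_ge0 : forall n u, 0 <= H n u.
Hypothesis H_noninc : forall m n u, (m <= n)%N -> H n u <= H m u.
Hypothesis H_mix : forall L (eps : R), 0 < eps ->
  exists r0, forall r p q u, (r0 <= r)%N -> (q <= L * r)%N ->
    H (p + r + q) u <= H p u * H q u + eps /\
    H p u * H q u <= H (p + r + q) u + (1 - H r u) + eps.
Hypothesis H_nondec : forall n u v, u <= v -> H n u <= H n v.
Hypothesis H_cont : forall n, continuous (H n).
Hypothesis H_Ny : H 1%N u @[u --> -oo] --> (0 : R).
Hypothesis H_y : forall n, H n u @[u --> +oo] --> (1 : R).

Let H_le1 n u : H n u <= 1.
Proof. by rewrite -(H0 u) H_noninc. Qed.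

Let gam : R := expR (-1).

Let gam_gt0 : 0 < gam. Proof. exact: expR_gt0. Qed.

Let gam_lt1 : gam < 1.
Proof. by rewrite -expR0 ltr_expR oppr_lt0. Qed.

(** A continuous stand-in for the indicator of [gam <= H n u]: 0 up to the level [gam], and 1 from
    [gam + n%:R^-1] on when [n > 0]. The factor [n] also kills the term [n = 0], so that times are
    counted from 1. *)
Definition level_weight n u : R := Num.max 0 (Num.min 1 (n%:R * (H n u - gam))).

Definition level_time N u : R := \sum_(0 <= n < N) level_weight n u.

(** A supremum, because the times [level_time N u] are unbounded in [N] exactly
where [H n u >= expR (-1)] for all [n]; there the value is 1. *)
Definition phantom_fun u : R :=
  sup (range (fun N => level_time N u / (level_time N u + 1))).

Let weight_ge0 n u : 0 <= level_weight n u.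
Proof. by rewrite /level_weight le_max lexx. Qed.

Let weight_le1 n u : level_weight n u <= 1.
Proof. by rewrite /level_weight ge_max ler01 ge_min lexx. Qed.

Let weight0 u : level_weight 0 u = 0.
Proof. by rewrite /level_weight mul0r minElt ltNge ler01/= maxxx. Qed.

Let weight_eq0 n u : H n u <= gam -> level_weight n u = 0.
Proof.
move=> h; rewrite /level_weight; apply/max_idPl.
by rewrite ge_min mulr_ge0_le0 ?orbT// subr_le0.
Qed.

Let weight_nondec n u v : u <= v -> level_weight n u <= level_weight n v.
Proof.
move=> uv; rewrite /level_weight ge_max le_max lexx/= le_max; apply/orP; right.
by rewrite le_min !ge_min lexx/= ler_wpM2l ?orbT// lerD2r H_nondec.
Qed.

Let weight_cont n : continuous (level_weight n).
Proof.
move=> u; pose g v := n%:R * (H n v - gam).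
have cg : {for u, continuous (g : R -> R^o)}.
  by apply: cvgM; [exact: cvg_cst|apply: cvgB; [exact: H_cont|exact: cvg_cst]].
have c1 : {for u, continuous (cst 1 : R -> R^o)} by exact: cvg_cst.
have c0 : {for u, continuous (cst 0 : R -> R^o)} by exact: cvg_cst.
exact: continuous_max c0 (continuous_min c1 cg).
Qed.

Let time_ge0 N u : 0 <= level_time N u.
Proof. by apply: sumr_ge0 => i _. Qed.

Let time_leN N u : level_time N.+1 u <= N%:R.
Proof.
rewrite /level_time big_nat_recl// weight0 add0r -[leRHS]mulr1n.
rewrite (le_trans (ler_sum _ (fun i _ => weight_le1 _ _)))//.
by rewrite big_mkord sumr_const card_ord.
Qed.

Let time_noninc M N u : (M <= N)%N -> level_time M u <= level_time N u.
Proof.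
move=> MN; rewrite /level_time (big_cat_nat (leq0n _) MN)//= lerDl.
by apply: sumr_ge0 => i _.
Qed.

Let time_nondec N u v : u <= v -> level_time N u <= level_time N v.
Proof. by move=> uv; apply: ler_sum => i _; exact: weight_nondec. Qed.

Let time_stable M N u : H M u <= gam -> (M <= N)%N ->
  level_time N u = level_time M u.
Proof.
move=> HM MN; rewrite /level_time (big_cat_nat (leq0n _) MN)//=.
rewrite [X in _ + X](_ : _ = 0) ?addr0// big_nat_cond big1// => i /andP[/andP[Mi _] _].
by rewrite weight_eq0// (le_trans _ HM)// H_noninc.
Qed.

Let ratio_cont N : continuous (fun u => level_time N u / (level_time N u + 1)).
Proof.
move=> u; have c : {for u, continuous (level_time N)}.
  rewrite /level_time; elim: N => [|N IH].
    rewrite (_ : (fun _ => _) = cst 0); first exact: cvg_cst.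
    by apply/funext => v; rewrite big_geq.
  rewrite (_ : (fun _ => _) =
    (fun v => \sum_(0 <= n < N) level_weight n v + level_weight N v)).
    by apply: cvgD => //; exact: weight_cont.
  by apply/funext => v; rewrite big_nat_recr.
apply: cvgM => //; apply: cvgV; first by rewrite gt_eqF// ltr_wpDl.
by apply: cvgD => //; exact: cvg_cst.
Qed.

Let ratio_le1 N u : level_time N u / (level_time N u + 1) <= 1.
Proof. by have /andP[_ /ltW] := ratio_ge0_lt1 (time_ge0 N u). Qed.

Lemma phantom_ge N u : level_time N u / (level_time N u + 1) <= phantom_fun u.
Proof.
by apply: ub_le_sup; [exists 1 => _ [M _ <-]|exists N].
Qed.

Lemma phantom_ge0 u : 0 <= phantom_fun u.
Proof.
have := phantom_ge 0 u; apply: le_trans.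
by have /andP[] := ratio_ge0_lt1 (time_ge0 0 u).
Qed.

Lemma phantom_le1 u : phantom_fun u <= 1.
Proof.
apply: ge_sup => [|_ [N _ <-]//].
by exists (level_time 0 u / (level_time 0 u + 1)), 0%N.
Qed.

Lemma phantom_nondecreasing : nondecreasing phantom_fun.
Proof.
move=> u v uv; apply: ge_sup.
  by exists (level_time 0 u / (level_time 0 u + 1)), 0%N.
move=> _ [N _ <-]; rewrite (le_trans _ (phantom_ge N v))//.
by apply: ler_ratio => //; exact: time_nondec.
Qed.

(** From [N] on all weights vanish, so the supremum is attained at [N]. Around a point with
    [H N u < gam] the phantom is thus a single continuous ratio. *)
Lemma phantom_below N u : H N u <= gam ->
  phantom_fun u = level_time N u / (level_time N u + 1).
Proof.
move=> HN; apply/eqP; rewrite eq_le phantom_ge andbT; apply: ge_sup.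
  by exists (level_time 0 u / (level_time 0 u + 1)), 0%N.
move=> _ [M _ <-]; have [MN|/ltnW NM] := leqP M N.
  by apply: ler_ratio => //; exact: time_noninc.
by rewrite (time_stable HN NM).
Qed.

(** By monotonicity the weights of [1, ..., N] are all at least [eta], so the level time is at least
    [N%:R * eta]. This is the source of values near 1. *)
Lemma phantom_above N u eta : 0 < eta <= 1 -> gam + eta <= H N u ->
  N%:R * eta / (N%:R * eta + 1) <= phantom_fun u.
Proof.
move=> /andP[n0 n1] HN; rewrite (le_trans _ (phantom_ge N.+1 u))//.
apply: ler_ratio; first by rewrite mulr_ge0// ltW.
rewrite /level_time big_nat_recl// weight0 add0r big_mkord.
rewrite -[N in N%:R]card_ord mulr_natl -sumr_const; apply: ler_sum => i _.
rewrite /level_weight le_max le_min n1/=; apply/orP; right.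
have h : eta <= H i.+1 u - gam by rewrite lerBrDl (le_trans HN)// H_noninc.
by rewrite (le_trans h)// ler_peMl ?ler1n// (le_trans (ltW n0)).
Qed.

(** A single value [H n u < 1] would, by [decay], bring later values below [gam]. So all are 1, and
    [phantom_above] applies with [eta = 1 - gam] and [N] arbitrarily large. *)
Lemma phantom_eq1 u : (forall n, gam <= H n u) ->
  phantom_fun u = 1 /\ forall n, H n u = 1.
Proof.
move=> Hg; have H1 n : H n u = 1.
  apply/eqP; rewrite eq_le H_le1 leNgt/=; apply/negP => Hn.
  have [|k [r0 [k0 hk]]] := @decay R H H0 H_ge0 H_noninc H_mix _ (gam / 2) Hn.
    by rewrite divr_gt0.
  have := hk (r0 + n)%N u (leq_addr _ _) (H_noninc _ (leq_addl _ _)).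
  have := gam_gt0; have := Hg (k * (r0 + n))%N; lra.
split=> //; apply/eqP; rewrite eq_le phantom_le1; apply/ler_addgt0Pr => e e0.
have [||N hN] := @ratio_near1 R (1 - gam) e; rewrite ?subr_gt0//.
rewrite -lerBlDr (le_trans hN)//; apply: phantom_above.
  by rewrite subr_gt0 gam_lt1/= gerBl ltW.
by rewrite H1 addrC subrK.
Qed.

(** The filter is arbitrary so as to serve both at [+oo] and at points where no [H n] is below
    [gam]. *)
Let near1_phantom (F : set_system R) {FF : Filter F} :
  (forall n, H n u @[u --> F] --> (1 : R)) -> phantom_fun u @[u --> F] --> (1 : R).
Proof.
move=> HF; apply/cvgrPdist_le => e e0.
have n0 : 0 < (1 - gam) / 2 by rewrite divr_gt0// subr_gt0.
have [N hN] := ratio_near1 n0 e0.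
have /cvgrPdist_le/(_ _ n0) := HF N; apply: filterS => u.
rewrite ler_norml => /andP[_ h].
have h1 : N%:R * ((1 - gam) / 2) / (N%:R * ((1 - gam) / 2) + 1) <= phantom_fun u.
  apply: phantom_above; first by rewrite n0/=; have := gam_gt0; lra.
  lra.
have h2 := phantom_le1 u.
rewrite ger0_norm; lra.
Qed.

Lemma phantom_continuous : continuous phantom_fun.
Proof.
move=> u; have [[N HN]|HN] := pselect (exists N, H N u < gam).
  have : \forall v \near u, H N v < gam.
 exact: (@cvgr_lt R R (nbhs u) (nbhs_filter u) (H N) (H N u) (@H_cont N u) gam HN).
  move=> near_u.
  rewrite /continuous_at (phantom_below (ltW HN)).
  apply: cvg_trans (@ratio_cont N u); apply: near_eq_cvg.
  by apply: filterS near_u => v Hv; rewrite (phantom_below (ltW Hv)).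
have [] := @phantom_eq1 u.
  by move=> n; rewrite leNgt; apply/negP => h; apply: HN; exists n.
rewrite /continuous_at => -> H1; apply: near1_phantom => n.
by rewrite -(H1 n); exact: H_cont.
Qed.

(** As soon as [H 1 u <= gam], only the zero weight of [n = 0] is left and the phantom is exactly
    0. *)
Lemma phantom_cvgNy : phantom_fun u @[u --> -oo] --> (0 : R).
Proof.
have near_Ny : \forall u \near -oo, H 1%N u < gam.
  by apply: (cvgr_lt (0 : R)).
apply: cvg_trans (@cvg_cst R 0 _ (-oo : set_system R) _); apply: near_eq_cvg.
apply: filterS near_Ny => u /ltW Hu.
by rewrite (phantom_below Hu) /level_time big_nat1 weight0 mul0r.
Qed.

Lemma phantom_cvgy : phantom_fun u @[u --> +oo] --> (1 : R).
Proof. exact: near1_phantom. Qed.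

(** By [asymp_exp], the weights are 1 for [n] from a constant [n1] up to about
    [(1 - delta / 2) * N]. Together with [time_leN] this makes the level time asymptotic to [N]. *)
Lemma level_time_asymp delta : 0 < delta <= 1 -> exists N0, forall N u,
  (N0 <= N)%N -> gam <= H N u -> H N.+1 u <= gam ->
  (1 - delta) * N%:R <= level_time N.+1 u.
Proof.
move=> /andP[d0 d1].
(* Then [gam * (1 + delta / 2) = gam + 2 * eta]: one [eta] absorbs the error of [asymp_exp], the
   other makes the weight 1 once [n >= eta^-1]. *)
pose eta := gam * delta / 4; have n0 : 0 < eta by rewrite divr_gt0// mulr_gt0.
have [N0 hN0] := @asymp_exp R H H0 H_ge0 H_noninc H_mix eta n0.
pose n1 := (Num.truncn eta^-1).+1.
exists (N0 + (Num.truncn (2 * n1%:R / delta)).+1)%N => N u hN HN HN1.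
have N0N : (N0 <= N)%N by exact: leq_trans (leq_addr _ _) hN.
have hn1 : n1%:R <= delta / 2 * N%:R.
  have h : 2 * n1%:R / delta <= N%:R.
    rewrite ltW// (lt_le_trans (truncnS_gt _))// ler_nat.
    exact: leq_trans (leq_addl _ _) hN.
  rewrite ler_pdivrMr// in h; lra.
have hx := hN0 N u N0N HN HN1.
have Npos : 0 < N%:R :> R.
  by rewrite ltr0n (leq_trans _ hN)// addnS.
pose m := (Num.truncn ((1 - delta / 2) * N%:R)).+1.
have x0 : 0 <= (1 - delta / 2) * N%:R by rewrite mulr_ge0//; lra.
have hm : (1 - delta / 2) * N%:R < m%:R by exact: truncnS_gt.
have hm' : m.-1%:R <= (1 - delta / 2) * N%:R by rewrite truncn_le.
have mN : (m <= N.+1)%N.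
  by rewrite ltnS -(ler_nat R) (le_trans hm')// ler_piMl//; lra.
have n1m : (n1 <= m)%N.
  rewrite -(ler_nat R) (le_trans hn1)// (le_trans _ (ltW hm))// ler_wpM2r//; lra.
rewrite /level_time (big_cat_nat (leq0n _) mN)//= (big_cat_nat (leq0n _) n1m)//=.
have s1 : 0 <= \sum_(0 <= n < n1) level_weight n u by apply: sumr_ge0 => i _.
have s2 : 0 <= \sum_(m <= n < N.+1) level_weight n u by apply: sumr_ge0 => i _.
have s3 : m%:R - n1%:R <= \sum_(n1 <= n < m) level_weight n u.
  rewrite -natrB// -sumr_const_nat big_nat_cond [leRHS]big_nat_cond.
  apply: ler_sum => i /andP[/andP[n1i im] _].
  rewrite /level_weight le_max le_min lexx/=; apply/orP; right.
  have iN : i%:R / N%:R <= 1 - delta / 2.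
    by rewrite ler_pdivrMr// (le_trans _ hm')// ler_nat.
  have := hx i; rewrite ler_norml => /andP[h1 _].
  have h2 : gam * (1 + delta / 2) <= expR (- (i%:R / N%:R)).
    rewrite (le_trans (ler_wpM2l (ltW gam_gt0) (expR_ge1Dx _)))//.
    by rewrite -expRD ler_expR; lra.
  have h3 : eta <= H i u - gam by rewrite /eta in h1 *; lra.
  have h4 : eta^-1 <= i%:R by rewrite ltW// (lt_le_trans (truncnS_gt _))// ler_nat.
  have : eta^-1 * eta <= i%:R * (H i u - gam).
    by rewrite ler_pM ?invr_ge0 ?(ltW n0).
  by rewrite mulVf ?gt_eqF.
lra.
Qed.

(** The level time [S] lies between [(1 - delta) * N] and [N], and [expR_ratio_bounds] squeezes the
    powers of [S / (S + 1)] between exponentials, whose time scales [expRN_scale_le] compares with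
    [N]. *)
Lemma phantom_asymp_exp eps : 0 < eps -> exists N0, forall N u,
  (N0 <= N)%N -> gam <= H N u -> H N.+1 u <= gam ->
  forall m, `|phantom_fun u ^+ m - expR (- (m%:R / N%:R))| <= eps.
Proof.
(* With [delta <= 1 / 2], [(1 - delta)^-1 - 1 <= 2 * delta <= eps]. *)
move=> e0; pose delta := Num.min (1 / 2) (eps / 2).
have d0 : 0 < delta by rewrite lt_min !divr_gt0.
have d2 : delta <= 1 / 2 by rewrite ge_min lexx.
have de : delta <= eps / 2 by rewrite ge_min lexx orbT.
have [|N0 hN0] := @level_time_asymp delta; first by rewrite d0/=; lra.
exists (N0 + (Num.truncn eps^-1).+1)%N => N u hN HN HN1 m.
have N0N : (N0 <= N)%N by exact: leq_trans (leq_addr _ _) hN.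
have eN : eps^-1 <= N%:R.
  rewrite ltW// (lt_le_trans (truncnS_gt _))// ler_nat.
  exact: leq_trans (leq_addl _ _) hN.
have Npos : 0 < N%:R :> R by rewrite (lt_le_trans _ eN)// invr_gt0.
have Ne : N%:R^-1 <= eps by rewrite -[leRHS]invrK lef_pV2 ?posrE ?invr_gt0.
rewrite (phantom_below HN1).
have := hN0 N u N0N HN HN1; have := time_leN N u.
set S := level_time _ _ => SN NS.
have d1N : 0 < (1 - delta) * N%:R by rewrite mulr_gt0//; lra.
have S0 : 0 < S by exact: lt_le_trans NS.
have /andP[l1 l2] := expR_ratio_bounds S0.
have x0 : 0 <= S / (S + 1) by rewrite divr_ge0 ?addr_ge0 ?ltW.
have u1 : (S / (S + 1)) ^+ m <= expR (- (m%:R / (N%:R + 1))).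
  rewrite (le_trans (lerXn2r _ _ _ l2)) ?nnegrE ?expR_ge0//.
  rewrite -expRM_natl ler_expR mulrN lerN2 ler_wpM2l//.
  by rewrite lef_pV2 ?posrE ?addr_gt0// lerD2r.
have u2 : expR (- (m%:R / ((1 - delta) * N%:R))) <= (S / (S + 1)) ^+ m.
  rewrite (le_trans _ (lerXn2r _ _ _ l1)) ?nnegrE ?expR_ge0//.
  by rewrite -expRM_natl ler_expR mulrN lerN2 ler_wpM2l// lef_pV2 ?posrE.
have u3 : expR (- (m%:R / (N%:R + 1))) - expR (- (m%:R / N%:R)) <= eps.
  rewrite (_ : m%:R / N%:R = (1 + N%:R^-1) * (m%:R / (N%:R + 1))); last first.
    by field; rewrite !gt_eqF// addr_gt0.
  rewrite (le_trans (expRN_scale_le _ _))//.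
    by rewrite lerDl invr_ge0.
  by move: Ne; lra.
have u4 : expR (- (m%:R / N%:R)) - expR (- (m%:R / ((1 - delta) * N%:R))) <= eps.
  have d1 : 0 < 1 - delta by lra.
  rewrite (_ : m%:R / (_ * _) = (1 - delta)^-1 * (m%:R / N%:R)); last first.
    by rewrite invfM mulrCA.
  rewrite (le_trans (expRN_scale_le _ _))//.
    by rewrite invf_ge1//; lra.
  by rewrite lerBlDr -div1r ler_pdivrMr//; nra.
rewrite ler_norml; lra.
Qed.

(** Three regimes: if [H] has fallen to [gam] by time [N0], both quantities are small; if it falls
    below [gam] later, with crossing time [M], both are near [expR (- (n%:R / M%:R))]; if it never
    does, both are 1. *)
Lemma phantom_approx eps : 0 < eps -> exists n0, forall n u, (n0 <= n)%N ->
  `|H n u - phantom_fun u ^+ n| <= eps.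
Proof.
move=> e0; have e20 : 0 < eps / 2 by rewrite divr_gt0.
have [N1 hN1] := @asymp_exp R H H0 H_ge0 H_noninc H_mix _ e20.
have [N2 hN2] := phantom_asymp_exp e20.
pose N0 := (N1 + N2)%N.
have [k [r0 [k0 hk]]] := @decay R H H0 H_ge0 H_noninc H_mix _ _ gam_lt1 e0.
have [||j hj] := @exists_expr_le R (N0%:R / (N0%:R + 1)) eps => //.
  exact: ratio_ge0_lt1.
exists (k * (r0 + N0) + j.+1)%N => n u hn.
have [h|h] := leP (H N0 u) gam; last first.
  have [[N hN]|hN] := pselect (exists N, H N u < gam); last first.
    have [|-> ->] := @phantom_eq1 u; last by rewrite expr1n subrr normr0 ltW.
    by move=> i; rewrite leNgt; apply/negP => hi; apply: hN; exists i.
  (* The least index below the level is a successor [M.+1], since [H 0 u = 1]. *)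
  case: (ex_minnP (ex_intro (fun N => H N u < gam) N hN)) => -[|M] HM minM.
    by move: HM; rewrite H0 ltNge (ltW gam_lt1).
  have HM' : gam <= H M u.
    by rewrite leNgt; apply/negP => /minM; rewrite ltnn.
  have N0M : (N0 <= M)%N.
    rewrite leqNgt; apply/negP => MN0.
    by have := lt_trans HM (lt_le_trans h (H_noninc u MN0)); rewrite ltxx.
  have := hN1 M u (leq_trans (leq_addr _ _) N0M) HM' (ltW HM) n.
  have := hN2 M u (leq_trans (leq_addl _ _) N0M) HM' (ltW HM) n.
  rewrite !ler_norml; lra.
(* Time [r0 + N0] replaces [N0] to meet the threshold of [decay]. In [a2], the phantom is bounded by
   the constant [N0%:R / (N0%:R + 1) < 1]. *)
have a1 : H n u <= eps.
  have h' : H (r0 + N0)%N u <= gam by rewrite (le_trans (H_noninc u (leq_addl _ _))).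
  apply: le_trans (hk (r0 + N0)%N u (leq_addr _ _) h').
  by apply: H_noninc; rewrite (leq_trans _ hn)// leq_addr.
have a2 : phantom_fun u ^+ n <= eps.
  have p1 : phantom_fun u <= N0%:R / (N0%:R + 1).
    rewrite (phantom_below h) ler_ratio// (le_trans _ (time_leN N0 u))//.
    exact: time_noninc.
  have jn : (j.+1 <= n)%N by rewrite (leq_trans _ hn)// leq_addl.
  rewrite (le_trans _ hj)// (le_trans (ler_wiXn2l _ _ jn)) ?phantom_ge0 ?phantom_le1//.
  by rewrite lerXn2r ?nnegrE ?phantom_ge0 ?divr_ge0 ?addr_ge0.
have a3 := H_ge0 n u; have a4 : 0 <= phantom_fun u ^+ n by rewrite exprn_ge0// phantom_ge0.
rewrite ler_norml; lra.
Qed.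

End phantom_construction.

(** * Test functions: the indicator of an orthant and its Lipschitz approximation *)

Section ramp.
Context (R : realType).
Implicit Types a b u e : R.

Lemma ler_dist_max0 a b : `|Num.max 0 a - Num.max 0 b| <= `|a - b|.
Proof.
have h1 := ler_norm (a - b); have h2 := ler_norm (b - a); rewrite distrC in h2.
by rewrite ler_norml; case: (leP 0 a) => ?; case: (leP 0 b) => ?; apply/andP; split; lra.
Qed.

Definition orthant u s : set (s.-tuple R) := [set x | forall k, tnth x k <= u].
Arguments orthant u s : clear implicits.

Lemma measurable_orthant u s : measurable (orthant u s).
Proof.
have -> : orthant u s = \big[setI/setT]_(k < s) ((@tnth s R ^~ k) @^-1` `]-oo, u]).
  rewrite -bigcap_seq; apply/seteqP; split => x /= xu k.
    by rewrite /= in_itv/=.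
  by have := xu k (mem_index_enum k); rewrite /= in_itv.
apply: bigsetI_measurable => k _; rewrite -[X in measurable X]setTI.
by apply: measurable_tnth => //; exact: measurable_itv.
Qed.

Lemma test_functions_orthant u s : (0 < s)%N ->
  test_functions (\1_(orthant u s) : s.-tuple R -> R).
Proof.
move=> s0; split.
- by apply: measurable_indic; exact: measurable_orthant.
- exists (nseq_tuple s u), (nseq_tuple s (u + 1)).
  have uP : nseq_tuple s u \in orthant u s by apply: mem_set => k; rewrite tnth_nseq.
  have uN : (nseq_tuple s (u + 1) \in orthant u s) = false.
    apply: memNset => /(_ (Ordinal s0)); rewrite tnth_nseq.
    by apply/negP; rewrite -ltNge ltrDl.
  by rewrite !indicE uP uN; apply/eqP; rewrite oner_eq0.
- by move=> x; rewrite indicE; case: (_ \in _); rewrite ?normr1 ?normr0.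
Qed.

(** The sum is the l1-distance from [x] to the orthant at level [u], matching the norm in [Lip]; the
    ramp falls linearly from 1 at distance 0 to 0 at distance [e]. *)
Definition ramp u e s (x : s.-tuple R) : R :=
  Num.max 0 (1 - (\sum_(k < s) Num.max 0 (tnth x k - u)) / e).

Lemma ramp_ge0 u e s x : 0 <= @ramp u e s x.
Proof. by rewrite /ramp le_max lexx. Qed.

Lemma ramp_le1 u e s x : 0 < e -> @ramp u e s x <= 1.
Proof.
move=> e0; rewrite /ramp ge_max ler01 gerBl divr_ge0 ?(ltW e0)//.
by apply: sumr_ge0 => k _; rewrite le_max lexx.
Qed.

Lemma ramp_eq1 u e s x : orthant u s x -> @ramp u e s x = 1.
Proof.
move=> xu; rewrite /ramp big1 ?mul0r ?subr0; first exact/max_idPr/ler01.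
by move=> k _; apply/max_idPl; rewrite subr_le0.
Qed.

Lemma ramp_eq0 u e s x : 0 < e -> ~ orthant (u + e) s x -> @ramp u e s x = 0.
Proof.
move=> e0 /existsNP[k /negP]; rewrite -ltNge => xk.
rewrite /ramp; apply/max_idPl; rewrite subr_le0 ler_pdivlMr// mul1r.
rewrite (bigD1 k)//= -[leLHS]addr0 lerD//.
  by rewrite le_max; apply/orP; right; rewrite lerBrDl ltW.
by apply: sumr_ge0 => j _; rewrite le_max lexx.
Qed.

Lemma ramp_lipschitz u e s x y : 0 < e ->
  `|@ramp u e s y - @ramp u e s x| <= (\sum_(k < s) `|tnth y k - tnth x k|) / e.
Proof.
move=> e0; rewrite (le_trans (ler_dist_max0 _ _))//.
rewrite [X in `|X|](_ : _ = (\sum_(k < s)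
    (Num.max 0 (tnth x k - u) - Num.max 0 (tnth y k - u))) / e); last first.
  by rewrite sumrB; ring.
rewrite normrM [`|e^-1|]gtr0_norm ?invr_gt0// ler_pM2r ?invr_gt0//.
rewrite (le_trans (ler_norm_sum _ _ _))// ler_sum// => k _.
rewrite (le_trans (ler_dist_max0 _ _))// distrC.
by rewrite (_ : _ - _ - _ = tnth y k - tnth x k)//; ring.
Qed.

Lemma ramp_nseq u e s : 0 < e -> (0 < s)%N ->
  @ramp u e s (nseq_tuple s u) = 1 /\ @ramp u e s (nseq_tuple s (u + e + e)) = 0.
Proof.
move=> e0 s0; split; first by apply: ramp_eq1 => k; rewrite tnth_nseq.
apply: ramp_eq0 => //= /(_ (Ordinal s0)); rewrite tnth_nseq.
by apply/negP; rewrite -ltNge ltrDl.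
Qed.

Lemma test_functions_ramp u e s : 0 < e -> (0 < s)%N ->
  test_functions (@ramp u e s).
Proof.
move=> e0 s0; split.
- apply: measurable_maxr => //; apply: measurable_funB => //.
  apply: measurable_funM => //; apply: measurable_sum => k.
  apply: measurable_maxr => //; apply: measurable_funB => //.
  exact: measurable_tnth.
- exists (nseq_tuple s u), (nseq_tuple s (u + e + e)).
  by have [-> ->] := ramp_nseq u e0 s0; apply/eqP; rewrite oner_eq0.
- by move=> x; rewrite ger0_norm ?ramp_ge0// ramp_le1.
Qed.

(** Positivity and finiteness allow the denominator of [theta] to be cleared. Positivity comes from
    the drop from 1 to 0 along the diagonal. *)
Lemma Lip_ramp u e s : 0 < e -> (0 < s)%N ->
  exists L : R, [/\ 0 < L, L <= e^-1 & Lip (@ramp u e s) = L%:E].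
Proof.
move=> e0 s0.
have ub : (Lip (@ramp u e s) <= (e^-1)%:E)%E.
  apply: ge_ereal_sup => _ [[x y] /= xy <-]; rewrite lee_fin.
  have h := ramp_lipschitz u x y e0.
  have : 0 <= \sum_(k < s) `|tnth y k - tnth x k| by apply: sumr_ge0.
  rewrite le_eqVlt => /predU1P[<-|S0]; first by rewrite invr0 mulr0 invr_ge0 ltW.
  by rewrite ler_pdivrMr// mulrC.
have lb : (0 < Lip (@ramp u e s))%E.
  pose x := nseq_tuple s u; pose y := nseq_tuple s (u + e + e).
  have [hx hy] := ramp_nseq u e0 s0.
  have xy : y <> x.
    move=> xy; have := hy; rewrite -/y xy hx => /eqP; by rewrite oner_eq0.
  apply: (@lt_le_trans _ _ (`|@ramp u e s y - @ramp u e s x| /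
     \sum_(k < s) `|tnth y k - tnth x k|)%:E); last first.
    by apply: ereal_sup_ubound; exists (x, y).
  rewrite hx hy sub0r normrN normr1 lte_fin div1r invr_gt0.
  rewrite (bigD1 (Ordinal s0))//= ltr_pwDl ?sumr_ge0//.
  by rewrite !tnth_nseq normr_gt0 subr_eq0 gt_eqF// -addrA ltrDl addr_gt0.
case: (Lip _) ub lb => [L||]//; rewrite !lee_fin !lte_fin => L1 L0.
by exists L.
Qed.

End ramp.

Arguments orthant {R} u s.
Arguments ramp {R} u e s x.

(** * Real-valued probabilities and covariances of indicators *)

Section real_probability.
Context d (T : measurableType d) (R : realType) (P : probability T R).
Implicit Types A B C : set T.

Definition pr A : R := fine (P A).

Lemma prE A : measurable A -> P A = (pr A)%:E.
Proof. by move=> mA; rewrite /pr fineK// fin_num_measure. Qed.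

Lemma pr_ge0 A : 0 <= pr A.
Proof. exact: fine_ge0. Qed.

Lemma pr_le1 A : measurable A -> pr A <= 1.
Proof. by move=> mA; rewrite -lee_fin -prE// probability_le1. Qed.

Lemma pr_mono A B : measurable A -> measurable B -> A `<=` B -> pr A <= pr B.
Proof.
by move=> mA mB AB; rewrite -lee_fin -!prE// le_measure// inE.
Qed.

Lemma pr_subU A B C : measurable A -> measurable B -> measurable C ->
  A `<=` B `|` C -> pr A <= pr B + pr C.
Proof.
move=> mA mB mC ABC; rewrite -lee_fin EFinD -!prE//.
rewrite (le_trans _ (measureU2 _ _ _))// le_measure ?inE//.
exact: measurableU.
Qed.

Lemma pr_sub_bigU A B n (C : nat -> set T) : measurable A -> measurable B ->
  (forall k, measurable (C k)) ->
  (forall w, A w -> B w \/ exists2 k, (k < n)%N & C k w) ->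
  pr A <= pr B + \sum_(k < n) pr (C k).
Proof.
move=> mA mB mC; elim: n B mB => [|n IH] B mB h.
  by rewrite big_ord0 addr0 pr_mono// => w /h [|[]].
rewrite big_ord_recr/=.
have mBC : measurable (B `|` C n) by exact: measurableU.
have hBC : pr (B `|` C n) <= pr B + pr (C n) by exact: pr_subU.
suff : pr A <= pr (B `|` C n) + \sum_(k < n) pr (C k) by lra.
apply: IH => // w /h [Bw|[k]]; first by left; left.
rewrite ltnS leq_eqVlt => /predU1P[->|kn] Cw; first by left; right.
by right; exists k.
Qed.

Lemma pr_setC A : measurable A -> pr (~` A) = 1 - pr A.
Proof.
move=> mA; apply: EFin_inj.
by rewrite -prE ?probability_setC ?EFinB ?prE//; exact: measurableC.
Qed.

Lemma Lfun1_unit_interval (f : T -> R) : measurable_fun [set: T] f ->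
  (forall w, 0 <= f w <= 1) -> f \in Lfun P 1.
Proof.
move=> mf f01; apply/Lfun1_integrable; apply: measurable_bounded_integrable => //.
  by rewrite (le_lt_trans (probability_le1 _ _)) ?ltry.
exists 1; split=> // y y1 w _ /=.
by have /andP[f0 f1] := f01 w; rewrite ger0_norm// (le_trans f1)// ltW.
Qed.

(** The expectation of [psi] exceeds [pr B], and that of [\1_A * psi] exceeds [pr (A & B)]
    (intersection), by an amount in [[0, D]]. These errors enter with opposite signs, so [D] is paid
    only once. *)
Lemma covariance_sandwich A B B' (psi : T -> R) c D :
  measurable A -> measurable B -> measurable B' -> measurable_fun [set: T] psi ->
  (forall w, \1_B w <= psi w <= \1_B' w) ->
  pr B' <= pr B + D -> pr (A `&` B') <= pr (A `&` B) + D ->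
  (`|covariance P \1_A psi| <= c%:E)%E ->
  `|pr (A `&` B) - pr A * pr B| <= c + D.
Proof.
move=> mA mB mB' mpsi psiB hD hAD hc.
have psi01 w : 0 <= psi w <= 1.
  have /andP[h1 h2] := psiB w; apply/andP; split.
    by rewrite (le_trans _ h1)// indicE.
  by rewrite (le_trans h2)// indicE; case: (_ \in _).
have mAB : measurable (A `&` B) by exact: measurableI.
have mAB' : measurable (A `&` B') by exact: measurableI.
have mApsi : measurable_fun [set: T] (\1_A * psi : T -> R).
  by apply: measurable_funM => //; exact: measurable_indic.
have Apsi01 w : 0 <= (\1_A * psi : T -> R) w <= 1.
  rewrite (_ : _ w = \1_A w * psi w)// indicE.
  by case: (_ \in _); rewrite ?mul1r ?mul0r ?lexx ?ler01.
have l1A : (\1_A : T -> R) \in Lfun P 1.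
  apply: Lfun1_unit_interval => [|w]; first exact: measurable_indic.
  by rewrite indicE; case: (_ \in _); rewrite ?lexx ?ler01.
have l1psi := Lfun1_unit_interval mpsi psi01.
have l1Apsi := Lfun1_unit_interval mApsi Apsi01.
have mono B1 B2 (f : T -> R) : measurable B1 -> measurable B2 ->
    measurable_fun [set: T] f -> (forall w, \1_B1 w <= f w <= \1_B2 w) ->
    exists x : R, [/\ ('E_P[f] = x%:E)%E, pr B1 <= x & x <= pr B2].
  move=> m1 m2 mf hf.
  have f01 w : 0 <= f w <= 1.
    have /andP[h1 h2] := hf w; apply/andP; split.
      by rewrite (le_trans _ h1)// indicE.
    by rewrite (le_trans h2)// indicE; case: (_ \in _).
  have Ef : ('E_P[f])%E \is a fin_num.
    by apply: expectation_fin_num; exact: Lfun1_unit_interval.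
  exists (fine 'E_P[f]%E); rewrite fineK//; split=> //.
    rewrite -lee_fin [leRHS]fineK// -prE// -expectation_indic//.
    apply: expectation_le => //.
    - by move=> w; have /andP[] := f01 w.
    - by apply: aeW => w; have /andP[] := hf w.
  rewrite -lee_fin [leLHS]fineK// -prE// -expectation_indic//.
  apply: expectation_le => //.
  - by move=> w; have /andP[] := f01 w.
  - by apply: aeW => w; have /andP[] := hf w.
have [x [Ex x1 x2]] := mono _ _ _ mB mB' mpsi psiB.
have [|y [Ey y1 y2]] := mono _ _ _ mAB mAB' mApsi.
  move=> w; rewrite !indicI (_ : (\1_A * psi) w = \1_A w * psi w)//=.
  have /andP[h1 h2] := psiB w.
  by rewrite !ler_wpM2l.
move: hc; rewrite covarianceE// Ex Ey expectation_indic// prE// -EFinM -EFinB.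
rewrite abse_EFin lee_fin !ler_norml => /andP[hc1 hc2].
have a0 := pr_ge0 A; have a1 := pr_le1 mA.
have D0 : 0 <= D by lra.
by apply/andP; split; nra.
Qed.

End real_probability.

(** * Block events of a stationary sequence *)

Section stationary_sequence.
Context d (T : measurableType d) (R : realType) (P : probability T R).
Variable X : nat -> {RV P >-> R}.
Hypothesis X_stationary : strictly_stationary X.
Implicit Types (u e c D : R) (p q r n : nat).

Definition below s p u : set T := [set w | forall k, (k < p)%N -> X (s + k)%N w <= u].

(** The function [H] of the abstract part. At [n = 0] the event is sure, whereas [partial_max X 0]
    is [X 0]; the two are matched for positive [n]. *)
Definition below_prob n u : R := pr P (below 0 n u).

Lemma tnth_iota_tuple p s (k : 'I_p) : tnth (iota_tuple p s) k = (s + k)%N.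
Proof. by rewrite (tnth_nth 0%N) nth_iota. Qed.

Lemma below_joint s p u : below s p u = joint X (iota_tuple p s) @^-1` orthant u p.
Proof.
apply/seteqP; split => w /= h.
  by move=> k; rewrite tnth_mktuple tnth_iota_tuple h.
by move=> k kp; have := h (Ordinal kp); rewrite tnth_mktuple tnth_iota_tuple.
Qed.

Lemma measurable_joint s (i : s.-tuple nat) : measurable_fun [set: T] (joint X i).
Proof.
apply/measurable_fun_tnthP => k; rewrite (_ : _ \o _ = X (tnth i k)) //.
by apply/funext => w /=; rewrite tnth_mktuple.
Qed.

Lemma measurable_below s p u : measurable (below s p u).
Proof.
rewrite below_joint -[X in measurable X]setTI.
by apply: measurable_joint => //; exact: measurable_orthant.
Qed.
Hint Resolve measurable_below : core.

Lemma pr_below s p u : pr P (below s p u) = below_prob p u.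
Proof.
rewrite /below_prob !below_joint /pr.
rewrite [iota_tuple p s](_ : _ = [tuple (tnth (iota_tuple p 0) k + s)%N | k < p]).
  by rewrite X_stationary//; exact: measurable_orthant.
by apply: eq_from_tnth => k; rewrite tnth_mktuple !tnth_iota_tuple add0n addnC.
Qed.

Lemma below_prob0 u : below_prob 0 u = 1.
Proof.
rewrite /below_prob (_ : below 0 0 u = setT) /pr ?probability_setT//.
by apply/seteqP; split => w.
Qed.

Lemma below_prob_ge0 n u : 0 <= below_prob n u.
Proof. exact: pr_ge0. Qed.

Lemma below_prob_noninc m n u : (m <= n)%N -> below_prob n u <= below_prob m u.
Proof.
by move=> mn; apply: pr_mono => // w h k km; apply: h; exact: leq_trans mn.
Qed.

Lemma below_prob_nondec n u v : u <= v -> below_prob n u <= below_prob n v.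
Proof.
by move=> uv; apply: pr_mono => // w h k km; apply: (le_trans (h _ km)).
Qed.

Lemma marginal_dfE u : marginal_df X u = below_prob 1 u.
Proof.
rewrite /marginal_df /cdf /distribution /pushforward /below_prob /pr.
congr (fine (P _)); apply/seteqP; split => w /=; rewrite in_itv/=.
  by move=> h [|k].
by move=> /(_ 0%N isT).
Qed.

Definition crossing s u v : set T := below s 1 v `\` below s 1 u.

Lemma measurable_crossing s u v : measurable (crossing s u v).
Proof. exact: measurableD. Qed.
Hint Resolve measurable_crossing : core.

Lemma pr_crossing s u v : u <= v ->
  pr P (crossing s u v) = marginal_df X v - marginal_df X u.
Proof.
move=> uv; rewrite !marginal_dfE -!(pr_below s) /crossing /pr measureD//=.
  rewrite setIidr ?fineB ?fin_num_measure//.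
  by move=> w h k k1; rewrite (le_trans (h k k1)).
by rewrite (le_lt_trans (probability_le1 _ _)) ?ltry.
Qed.

Lemma below_crossing s p u v w : below s p v w ->
  below s p u w \/ exists2 k, (k < p)%N & crossing (s + k) u v w.
Proof.
move=> h; have [hu|/existsNP[k /not_implyP[kp ku]]] := pselect (below s p u w).
  by left.
right; exists k => //; split => /=; first by move=> [|//] _; rewrite addn0 h.
by move=> /(_ 0%N isT); rewrite addn0.
Qed.

(** Raising the level from [u] to [v] admits only outcomes where one of the [p] variables lies in
    []u, v]]; a union bound gives the factor [p]. *)
Lemma pr_capI_below_le A s p u v D : measurable A -> u <= v ->
  marginal_df X v - marginal_df X u <= D ->
  pr P (A `&` below s p v) <= pr P (A `&` below s p u) + p%:R * D.
Proof.
move=> mA uv hD.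
have mAb t : measurable (A `&` below s p t) by exact: measurableI.
have := @pr_sub_bigU _ _ _ P _ _ p (fun k => crossing (s + k) u v) (mAb v) (mAb u)
  (fun k => measurable_crossing (s + k) u v).
move=> /(_ _)/le_trans; apply.
  by move=> w [Aw /(below_crossing u)[|]]; [left|right].
rewrite lerD2l -[p in leRHS]card_ord mulr_natl -sumr_const ler_sum// => k _.
by rewrite pr_crossing.
Qed.

Lemma below_prob_sub n u v : u <= v ->
  below_prob n v - below_prob n u <= n%:R * (marginal_df X v - marginal_df X u).
Proof.
move=> uv; rewrite lerBlDl.
have := @pr_capI_below_le setT 0 n u v _ measurableT uv (lexx _).
by rewrite !setTI.
Qed.

Lemma below_prob_ge n u : 1 - n%:R * (1 - marginal_df X u) <= below_prob n u.
Proof.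
rewrite lerBlDr; have mC k : measurable (~` below k 1 u) by exact: measurableC.
have := @pr_sub_bigU _ _ _ P setT (below 0 n u) n (fun k => ~` below k 1 u)
  measurableT (measurable_below _ _ _) mC.
rewrite /pr probability_setT/= -/(pr _ _) => /(_ _)/le_trans; apply.
  move=> w _; have [hu|/existsNP[k /not_implyP[kp ku]]] := pselect (below 0 n u w).
    by left.
  by right; exists k => // /(_ 0%N isT); rewrite addn0.
rewrite lerD2l -[n in leRHS]card_ord mulr_natl -sumr_const ler_sum// => k _.
by rewrite -/(pr _ _) pr_setC// pr_below marginal_dfE.
Qed.

(** Forgetting the middle block adds only outcomes where one of its [r] variables exceeds [u]. *)
Lemma below_prob_gap p q r u :
  below_prob (p + r + q) u <= pr P (below 0 p u `&` below (p + r) q u)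
    <= below_prob (p + r + q) u + (1 - below_prob r u).
Proof.
have mI : measurable (below 0 p u `&` below (p + r) q u) by exact: measurableI.
apply/andP; split.
  apply: pr_mono => // w h; split=> k kp; first by apply: h; lia.
  by apply: (h (p + r + k)%N); lia.
rewrite -(pr_below p r) -pr_setC// pr_subU//; first exact: measurableC.
move=> w [h1 h2]; have [hu|] := pselect (below p r u w); last by right.
left=> k kn; rewrite add0n.
have [kp|pk] := ltnP k p; first exact: h1.
have [kr|rk] := ltnP k (p + r).
  by rewrite -(subnKC pk); apply: hu; lia.
by rewrite -(subnKC rk); apply: h2; lia.
Qed.

Lemma covariance_le_theta p q r u e c : (0 < p)%N -> (0 < q)%N -> 0 < e ->
  (theta X r <= c%:E)%E ->
  (`|covariance P \1_(below 0 p u) (ramp u e q \o joint X (iota_tuple q (p + r)))|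
     <= (q%:R / e * c)%:E)%E.
Proof.
move=> p0 q0 e0 hth.
have [L [L0 L1 LE]] := Lip_ramp u e0 q0.
set cov := covariance P _ _.
have qL0 : 0 < q%:R * L by rewrite mulr_gt0// ltr0n.
have : (`|cov| * ((q%:R * L)^-1)%:E <= c%:E)%E.
  apply: le_trans hth; apply: ereal_sup_ubound.
  exists p, q, (\1_(orthant u p)), (ramp u e q), (iota_tuple p 0), (iota_tuple q (p + r)).
  split=> //.
  - by split; [exact: test_functions_orthant|exact: test_functions_ramp].
  - rewrite /=; apply: (@subseq_sorted _ leq leq_trans _ (iota 0 (p + r + q))).
      by rewrite !iotaD !add0n -catA cat_subseq// suffix_subseq.
    exact: iota_sorted.
  (* The first block ends at index [p - 1] and the second starts at [p + r]. *)
  - rewrite /= -nth_last size_iota nth_iota ?prednK//.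
    by case: q q0 {qL0 cov LE L1 L0 L} => // q _ /=; lia.
  - rewrite LE -EFinM inver gt_eqF//; congr (`|covariance P _ _| * _)%E.
    by apply/funext => w; rewrite /= !indicE below_joint.
move=> h; have c0 : 0 <= c.
  by rewrite -lee_fin (le_trans _ h)// mule_ge0// lee_fin invr_ge0 ltW.
rewrite lee_pdivrMr// in h; rewrite (le_trans h)// -EFinM lee_fin.
by rewrite mulrC ler_wpM2r// ler_pM2l// ltr0n.
Qed.

(** The first error is the covariance with a ramp of width [e], the second the cost of replacing the
    indicator of the second block by that ramp. *)
Lemma below_prob_cap_dist p q r u e c D : 0 < e -> 0 <= c ->
  (theta X r <= c%:E)%E ->
  marginal_df X (u + e) - marginal_df X u <= D ->
  `|pr P (below 0 p u `&` below (p + r) q u) - below_prob p u * below_prob q u|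
    <= q%:R / e * c + q%:R * D.
Proof.
move=> e0 c0 hth hD.
have ue : u <= u + e by rewrite lerDl ltW.
have D0 : 0 <= D.
  by rewrite (le_trans _ hD)// subr_ge0 !marginal_dfE below_prob_nondec.
have rhs0 : 0 <= q%:R / e * c + q%:R * D.
  by rewrite addr_ge0 ?mulr_ge0 ?invr_ge0// ltW.
have below_0 s : below s 0 u = setT by apply/seteqP; split => w.
(* Empty blocks are settled apart, as [theta] ranges over nonempty index tuples. *)
have [->|p0] := posnP p.
  by rewrite below_0 setTI pr_below below_prob0 mul1r subrr normr0.
have [q_0|q0] := posnP q.
  by rewrite {1 2}q_0 below_0 setIT below_prob0 mulr1 pr_below subrr normr0.
rewrite -(pr_below (p + r) q) /below_prob.
have ub A : measurable A -> _ := fun mA => pr_capI_below_le (p + r) q mA ue hD.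
apply: (covariance_sandwich (B' := below (p + r) q (u + e))) (ub _ _)
  (covariance_le_theta u p0 q0 e0 hth) => //.
- apply: measurableT_comp; last exact: measurable_joint.
  by have [] := test_functions_ramp u e0 q0.
- move=> w; rewrite !below_joint !indicE /=; apply/andP; split.
    case: (boolP (_ \in _)) => [/set_mem/= h|_]; last exact: ramp_ge0.
    by rewrite ramp_eq1.
  case: (boolP (_ \in _)) => [_|/negP h]; first exact: ramp_le1.
  by rewrite ramp_eq0// => hw; apply: h; apply: mem_set.
- by have := ub _ measurableT; rewrite !setTI.
Qed.

End stationary_sequence.

(** * Negative powers, and packaging of continuous distribution functions *)

Lemma powRN_le_near (R : realType) (K kappa eps : R) : 0 <= K -> 0 < kappa -> 0 < eps ->
  exists r0, forall r, (r0 <= r)%N -> K * r%:R `^ (- kappa) <= eps.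
Proof.
move=> K0 k0 e0; pose x := (K / eps) `^ kappa^-1.
exists (Num.truncn x).+1 => r hr.
have xr : x <= r%:R by rewrite ltW// (lt_le_trans (truncnS_gt _))// ler_nat.
have r0 : 0 < r%:R :> R by rewrite ltr0n (leq_trans _ hr).
rewrite powRN ler_pdivrMr ?powR_gt0// mulrC -ler_pdivrMr//.
have -> : K / eps = x `^ kappa.
  by rewrite /x -powRrM mulVf ?gt_eqF// powRr1// divr_ge0// ltW.
by rewrite ge0_ler_powR ?nnegrE ?powR_ge0// ltW.
Qed.

Lemma cumulativeBounded_of_continuous (R : realType) (g : R -> R) :
  nondecreasing g -> continuous g -> g @ -oo --> (0 : R) -> g @ +oo --> (1 : R) ->
  exists G : cumulativeBounded (0 : R) (1 : R), (G : R -> R) = g.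
Proof.
move=> ng cg g0 g1.
pose c := isCumulative.Build R _ R g ng (right_continuousW cg).
pose b := isCumulativeBounded.Build R 0 1 g g0 g1.
by exists (HB.pack_for (cumulativeBounded (0 : R) (1 : R)) g c b).
Qed.

(** * The mixing inequality from the decay of [theta] *)

Section theta_mixing.
Context d (T : measurableType d) (R : realType) (P : probability T R).
Variables (X : nat -> {RV P >-> R}) (b B C beta : R).
Hypothesis X_stationary : strictly_stationary X.
Hypothesis b_gt0 : 0 < b.
Hypothesis B_gt0 : 0 < B.
Hypothesis marginal_holder : forall x u : R, 0 < u ->
  marginal_df X (x + u) - marginal_df X x <= B * u `^ b.
Hypothesis beta_gt : 1 + b^-1 < beta.
Hypothesis theta_le : \forall r \near \oo,
  (theta X r <= (C * r%:R `^ (- beta))%:E)%E.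

Lemma below_prob_cap_asymp L eps : 0 < eps -> exists r0, forall r p q u,
  (r0 <= r)%N -> (q <= L * r)%N ->
  `|pr P (below X 0 p u `&` below X (p + r) q u) -
    below_prob X p u * below_prob X q u| <= eps.
Proof.
(* The midpoint of []b^-1, beta - 1[]. With [e = r ^ (- s)] and [q <= L * r], the two errors are of
   order [r ^ (1 + s - beta)] and [r ^ (1 - s * b)], both with negative exponents. *)
move=> eps0; pose s := (b^-1 + beta - 1) / 2.
have bs : 0 < s * b - 1.
  rewrite subr_gt0 -ltr_pdivrMr// div1r /s; move: beta_gt; lra.
have sb : 0 < beta - s - 1 by rewrite /s; move: beta_gt; lra.
have e20 : 0 < eps / 2 by rewrite divr_gt0.
have [r1 hr1] := powRN_le_near (mulr_ge0 (ler0n R L) (normr_ge0 C)) sb e20.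
have [r2 hr2] := powRN_le_near (mulr_ge0 (ler0n R L) (ltW B_gt0)) bs e20.
have [r3 _ hr3] := theta_le.
exists (r1 + r2 + r3).+1 => r p q u hr qL.
have r0 : 0 < r%:R :> R by rewrite ltr0n (leq_ltn_trans _ hr).
have r1r : (r1 <= r)%N by rewrite (leq_trans _ (ltnW hr))// -addnA leq_addr.
have r2r : (r2 <= r)%N by rewrite (leq_trans _ (ltnW hr))// addnAC leq_addl.
have r3r : (r3 <= r)%N by rewrite (leq_trans _ (ltnW hr))// leq_addl.
have r_neq0 : r%:R != 0 :> R by rewrite gt_eqF.
pose e := r%:R `^ (- s); have e0 : 0 < e by rewrite powR_gt0.
pose c := `|C| * r%:R `^ (- beta).
have c0 : 0 <= c by rewrite mulr_ge0// powR_ge0.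
have hth : (theta X r <= c%:E)%E.
  by rewrite (le_trans (hr3 r r3r))// lee_fin ler_wpM2r ?powR_ge0// ler_norm.
have := below_prob_cap_dist X_stationary p q e0 c0 hth (marginal_holder u e0).
move=> /le_trans; apply; rewrite (splitr eps) lerD//.
  apply: le_trans (hr1 r r1r).
  have -> : L%:R * `|C| * r%:R `^ (- (beta - s - 1)) = (L * r)%:R / e * c.
    have -> : - (beta - s - 1) = 1 + s + - beta by ring.
    rewrite !powRD ?r_neq0 ?implybT// powRr1 ?ltW// natrM /c /e [_ `^ (- s)]powRN invrK.
    ring.
  by rewrite !ler_wpM2r ?invr_ge0 ?(ltW e0)// ler_nat.
apply: le_trans (hr2 r r2r).
have -> : L%:R * B * r%:R `^ (- (s * b - 1)) = (L * r)%:R * (B * e `^ b).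
  have -> : - (s * b - 1) = 1 + (- s) * b by ring.
  rewrite powRD ?r_neq0 ?implybT// powRr1 ?ltW// natrM /e -powRrM; ring.
by rewrite ler_wpM2r ?mulr_ge0 ?powR_ge0 ?(ltW B_gt0)// ler_nat.
Qed.

Lemma below_prob_mix L eps : 0 < eps -> exists r0, forall r p q u,
  (r0 <= r)%N -> (q <= L * r)%N ->
  below_prob X (p + r + q) u <= below_prob X p u * below_prob X q u + eps /\
  below_prob X p u * below_prob X q u
    <= below_prob X (p + r + q) u + (1 - below_prob X r u) + eps.
Proof.
move=> /(below_prob_cap_asymp L)[r0 hr0]; exists r0 => r p q u hr hq.
have := hr0 r p q u hr hq; have := below_prob_gap X_stationary p q r u.
by rewrite ler_norml => /andP[? ?] /andP[? ?]; split; lra.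
Qed.

End theta_mixing.

(** * Continuity and limits of [below_prob], and the passage to maxima *)

Section below_prob_regularity.
Context d (T : measurableType d) (R : realType) (P : probability T R).
Variable X : nat -> {RV P >-> R}.
Hypothesis X_stationary : strictly_stationary X.

Lemma below_prob_dist n u v :
  `|below_prob X n u - below_prob X n v| <=
  n%:R * `|marginal_df X u - marginal_df X v|.
Proof.
have main x y : x <= y -> `|below_prob X n x - below_prob X n y| <=
    n%:R * `|marginal_df X x - marginal_df X y|.
  move=> xy; rewrite distrC [X in _ * X]distrC.
  rewrite !ger0_norm ?subr_ge0 ?marginal_dfE ?below_prob_nondec//.
  by rewrite -!marginal_dfE below_prob_sub.
have [uv|/ltW vu] := leP u v; first exact: main.
by rewrite distrC [X in _ * X]distrC main.
Qed.

Lemma continuous_below_prob n :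
  continuous (marginal_df X) -> continuous (below_prob X n).
Proof.
move=> cF u; apply/cvgrPdist_le => e e0.
have e'0 : 0 < e / n.+1%:R by rewrite divr_gt0.
have /cvgrPdist_le/(_ _ e'0) := cF u; apply: filterS => v h.
rewrite (le_trans (below_prob_dist _ _ _))//.
rewrite (le_trans (ler_wpM2l _ h))// mulrCA ler_piMr ?(ltW e0)//.
by rewrite ler_pdivrMr// mul1r ler_nat.
Qed.

Lemma below_prob_cvgNy : below_prob X 1 u @[u --> -oo] --> (0 : R).
Proof.
have -> : below_prob X 1 = marginal_df X.
  by apply/funext => u; rewrite marginal_dfE.
exact/fine_cvg/cvg_cdfNy0.
Qed.

Lemma below_prob_cvgy n : below_prob X n u @[u --> +oo] --> (1 : R).
Proof.
have cF : marginal_df X u @[u --> +oo] --> (1 : R).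
  exact/fine_cvg/cvg_cdfy1.
apply/cvgrPdist_le => e e0.
have e'0 : 0 < e / n.+1%:R by rewrite divr_gt0.
have /cvgrPdist_le/(_ _ e'0) := cF; apply: filterS => u.
rewrite ler_norml => /andP[_ h].
have h1 := below_prob_ge X_stationary n u.
have h2 : below_prob X n u <= 1 by rewrite -(below_prob0 X u) below_prob_noninc.
rewrite ger0_norm ?subr_ge0//.
have h3 : n%:R * (1 - marginal_df X u) <= e.
  rewrite (le_trans (ler_wpM2l _ h))// mulrCA ler_piMr ?(ltW e0)//.
  by rewrite ler_pdivrMr// mul1r ler_nat.
lra.
Qed.

Lemma prob_partial_max_le n u : (0 < n)%N ->
  P [set w | partial_max X n w <= u] = (below_prob X n u)%:E.
Proof.
move=> n0; rewrite -prE; last exact: measurable_below.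
congr (P _); apply/seteqP; split => w /= h.
  move=> k kn; rewrite add0n; apply: le_trans h.
  exact: (le_bigmax _ (fun j : 'I_n => X j w) (Ordinal kn)).
by apply: bigmax_le => [|j _]; [exact: (h 0%N)|exact: h].
Qed.

Lemma phantom_dfP (G : cumulativeBounded (0 : R) (1 : R)) :
  (forall eps, 0 < eps -> exists n0, forall n u, (n0 <= n)%N ->
    `|below_prob X n u - G u ^+ n| <= eps) ->
  phantom_df X G.
Proof.
move=> hG; rewrite /phantom_df; set S := fun n => ereal_sup _.
have S_ge0 n : (0 <= S n)%E.
  apply: le_trans (ereal_sup_ubound _); last by exists 0.
  exact: abse_ge0.
have S_le eps : 0 < eps -> \forall n \near \oo, (S n <= eps%:E)%E.
  (* The successor ensures [n > 0], as [prob_partial_max_le] requires. *)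
  move=> /hG[n0 h]; exists n0.+1 => // n /= n0n.
  apply: ge_ereal_sup => _ [u _ <-].
  rewrite prob_partial_max_le ?(leq_ltn_trans _ n0n)//.
  by rewrite -EFinB abse_EFin lee_fin h// ltnW.
have S_fin n eps : (S n <= eps%:E)%E -> S n \is a fin_num.
  by move=> h; rewrite ge0_fin_numE// (le_lt_trans h)// ltry.
apply/fine_cvgP; split.
  by have := S_le 1 ltr01; apply: filterS => n /S_fin.
apply/cvgrPdist_le => eps /S_le; apply: filterS => n h.
by rewrite sub0r normrN ger0_norm ?fine_ge0// -lee_fin fineK ?(S_fin _ _ h).
Qed.

End below_prob_regularity.

Theorem theorem4p7 (d : measure_display) (T : measurableType d) (R : realType)
    (P : probability T R) (X : nat -> {RV P >-> R}) (b B beta : R) :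
  strictly_stationary X ->
  continuous (marginal_df X) ->
  0 < b -> 0 < B ->
  (forall x u : R, 0 < u ->
     marginal_df X (x + u) - marginal_df X x <= B * u `^ b) ->
  theta_weakly_dependent X ->
  (1 + Num.sqrt 5) / 2 * (1 + b^-1) < beta ->
  (exists C : R, \forall r \near \oo,
      (theta X r <= (C * r%:R `^ (- beta))%:E)%E) ->
  exists G : cumulativeBounded (0 : R) (1 : R),
    continuous G /\ phantom_df X G.
Proof.
move=> stat cF b0 B0 holder _ beta_gt [C hC].
(* Since [(1 + sqrt 5) / 2 >= 1], the interval []b^-1, beta - 1[] for the exponent of the ramp width
   is nonempty. *)
have beta1 : 1 + b^-1 < beta.
  have s1 : 1 <= Num.sqrt 5 :> R by rewrite -[leLHS]sqrtr1 ler_wsqrtr ?ler1n.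
  have b1 : 0 < 1 + b^-1 by rewrite addr_gt0// invr_gt0.
  by apply: le_lt_trans beta_gt; rewrite ler_peMl ?(ltW b1)//; lra.
have mix := below_prob_mix stat b0 B0 holder beta1 hC.
have H0 := below_prob0 X; have Hge0 := below_prob_ge0 X.
have Hni m n u := @below_prob_noninc _ _ _ _ X m n u.
have Hnd n u v := @below_prob_nondec _ _ _ _ X n u v.
have Hc n := continuous_below_prob (n := n) stat cF.
have Hy := below_prob_cvgy stat.
have [|||| G EG] := @cumulativeBounded_of_continuous R (phantom_fun (below_prob X)).
- exact: phantom_nondecreasing.
- exact: phantom_continuous.
- by apply: phantom_cvgNy => //; exact: below_prob_cvgNy.
- exact: phantom_cvgy.
exists G; split; first by rewrite EG; exact: phantom_continuous.
by apply: phantom_dfP => // eps e0; rewrite EG; exact: phantom_approx.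
Qed.
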